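(* Let $u=(U(x,t),0,0)$, with a given function $P=P(x,t)$, be a solution for all $t\in\mathbb{R}$ of the Navier-Stokes equations $$\frac{\partial}{\partial t}u+(u\cdot\nabla)u=\nu\Delta u-\nabla P,\qquad \nabla\cdot u=0$$ in the channel $\mathcal{O}=\mathbb{R}\times\mathbb{R}\times[0,h]$ with the no-slip condition $u=0$ on $\{x_3=0\}\cup\{x_3=h\}$, and suppose that: (i) $u\in C^\infty(\mathcal{O}\times\mathbb{R})$; (ii) $u$ is periodic in $x_1$ and $x_2$ with periods $\Pi_1$ and $\Pi_2$ respectively; (iii) $\sup_{t\in\mathbb{R}}\int_0^{\Pi_1}\int_0^{\Pi_2}\int_0^h u(x,t)\cdot u(x,t)\,dx<\infty$. If, additionally, $\tilde p_1(t)=\partial P/\partial x_1$ is equal to a constant $\tilde p_{10}\in\mathbb{R}$ for all $t$, then $U=U(x_3,t)$ and $$U(x_3,t)=\sum_{k=1}^{\infty}\frac{2\tilde p_{10}h^2}{\nu(k\pi)^3}\left((-1)^k-1\right)\sin\left(\frac{\pi k x_3}{h}\right)=-\frac{\tilde p_{10}}{2\nu}x_3(h-x_3).$$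
   Context: Here $x=(x_1,x_2,x_3)$; $\nu>0$ (kinematic viscosity), $h>0$, $\Pi_1,\Pi_2>0$ are constants. $P=p+\Phi$ is the sum of the pressure $p(x,t)$ and a time-independent potential $\Phi(x)$. For solutions of the form $u=(U,0,0)$ the equations force $P$ to be of the form $P=\tilde p_0(t)+x_1\tilde p_1(t)$, which defines $\tilde p_1(t)$. *)

(* Defs.v *)
From Stdlib Require Import Reals.
From Coquelicot Require Import Coquelicot.
Open Scope R_scope.

(* ((x1, x2, x3), t) *)
Definition spacetime : Type := ((R * R * R) * R)%type.

Inductive axis : Type := ax1 | ax2 | ax3.
Inductive var : Type := Space (i : axis) | Time.

Definition sum_axes (f : axis -> R) : R := f ax1 + f ax2 + f ax3.

Definition shift (v : var) (s : R) (q : spacetime) : spacetime :=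
  let '((x1, x2, x3), t) := q in
  match v with
  | Space ax1 => ((x1 + s, x2, x3), t)
  | Space ax2 => ((x1, x2 + s, x3), t)
  | Space ax3 => ((x1, x2, x3 + s), t)
  | Time => ((x1, x2, x3), t + s)
  end.

(* The increment s only ranges over values keeping the point in D, so that
   the derivative depends only on the restriction of f to D and is one-sided
   at the walls of the channel. *)
Definition is_partial (D : spacetime -> Prop) (v : var) (f : spacetime -> R)
    (q : spacetime) (l : R) : Prop :=
  filterlim (fun s => (f (shift v s q) - f q) / s)
    (within (fun s => D (shift v s q)) (locally' 0)) (locally l).

Definition ex_partial (D : spacetime -> Prop) (v : var) (f : spacetime -> R) : Prop :=
  forall q, D q -> exists l, is_partial D v f q l.

(* Arbitrary value where the limit does not exist. *)
Definition partial (D : spacetime -> Prop) (v : var) (f : spacetime -> R) : spacetime -> R :=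
  fun q => iota (is_partial D v f q).

Fixpoint Ck_on (D : spacetime -> Prop) (k : nat) (f : spacetime -> R) : Prop :=
  continuous_on D f /\
  match k with
  | O => True
  | S m => forall v, ex_partial D v f /\ Ck_on D m (partial D v f)
  end.

(* C^oo up to the boundary of D. *)
Definition smooth_on (D : spacetime -> Prop) (f : spacetime -> R) : Prop :=
  forall k, Ck_on D k f.

Definition vector_field : Type := axis -> spacetime -> R.

Definition advection (D : spacetime -> Prop) (u : vector_field) (j : axis) (q : spacetime) : R :=
  sum_axes (fun i => u i q * partial D (Space i) (u j) q).

Definition laplacian (D : spacetime -> Prop) (f : spacetime -> R) (q : spacetime) : R :=
  sum_axes (fun i => partial D (Space i) (partial D (Space i) f) q).

Definition divergence (D : spacetime -> Prop) (u : vector_field) (q : spacetime) : R :=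
  sum_axes (fun i => partial D (Space i) (u i) q).

(* P is only required to possess a spatial gradient on D; the derivatives of
   u are meaningful once u is smooth. *)
Definition navier_stokes (D : spacetime -> Prop) (nu : R) (u : vector_field)
    (P : spacetime -> R) : Prop :=
  (forall i, ex_partial D (Space i) P) /\
  (forall j q, D q ->
     partial D Time (u j) q + advection D u j q
     = nu * laplacian D (u j) q - partial D (Space j) P q) /\
  (forall q, D q -> divergence D u q = 0).

(* (R x R x [0,h]) x R *)
Definition channel (h : R) (q : spacetime) : Prop :=
  let '((x1, x2, x3), t) := q in 0 <= x3 <= h.

Definition no_slip (h : R) (u : vector_field) : Prop :=
  forall i x1 x2 t, u i ((x1, x2, 0), t) = 0 /\ u i ((x1, x2, h), t) = 0.

Definition periodic_on (D : spacetime -> Prop) (i : axis) (period : R) (u : vector_field) : Prop :=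
  forall j q, D q -> u j (shift (Space i) period q) = u j q.

Definition cell_energy (Pi1 Pi2 h : R) (u : vector_field) (t : R) : R :=
  RInt (fun x1 => RInt (fun x2 => RInt (fun x3 =>
    sum_axes (fun i => u i ((x1, x2, x3), t) * u i ((x1, x2, x3), t)))
    0 h) 0 Pi2) 0 Pi1.

Definition parallel_flow (U : spacetime -> R) : vector_field :=
  fun i => match i with ax1 => U | _ => fun _ => 0 end.

(* Main.v *)
Require Import Defs.
From Stdlib Require Import Reals Lra Lia ClassicalEpsilon.
From Coquelicot Require Import Coquelicot.
Open Scope R_scope.

(** Incompressibility makes [U] independent of [x1], so that
    [w = U + p10 / (2 nu) x3 (h - x3)] solves the heat equation in [(x2, x3)] with
    zero values on the walls and period [Pi2] in [x2].  The weighted energy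
    [G(t) = int int w^2 sin (PI x3 / h)] satisfies [G' <= - nu (PI / h)^2 G]; being
    bounded as [t -> -oo], it vanishes, hence [w = 0].

    The sine series of the parabola reduces to
    [sum_j sin ((2j+1) x) / (2j+1)^3 = PI x (PI - x) / 8].  The second derivative
    of the remainder is [sum_(j <= n) sin ((2j+1) x) / (2j+1) - PI / 4], which is
    [O (1 / (n sin x))] by Leibniz' series at [PI / 2] and the closed form of
    [sum_(j <= n) cos ((2j+1) x)]; two integrations from [PI / 2] and [0] give the
    convergence. *)

(** * The sine series of the parabola *)

Definition odd_num (j : nat) : R := 2 * INR j + 1.

Definition odd_sin_sum (p n : nat) (x : R) : R :=
  sum_n (fun j => sin (odd_num j * x) / odd_num j ^ p) n.

Definition odd_cos_sum (p n : nat) (x : R) : R :=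
  sum_n (fun j => cos (odd_num j * x) / odd_num j ^ p) n.

Lemma odd_num_ge1 (j : nat) : 1 <= odd_num j.
Proof. unfold odd_num; pose proof (pos_INR j); lra. Qed.

(** Each step of the index adds [PI] to the argument and flips both signs. Hence at [PI / 2] the
    cosine sums vanish and the sine sum of order 1 is Leibniz' series, which makes it the base point
    of the estimates. *)
Lemma odd_num_half_pi (j : nat) :
  cos (odd_num j * (PI / 2)) = 0 /\ sin (odd_num j * (PI / 2)) = (-1) ^ j.
Proof.
  unfold odd_num; induction j as [|j [IHc IHs]].
  - simpl; replace ((2 * 0 + 1) * (PI / 2)) with (PI / 2) by field.
    rewrite cos_PI2, sin_PI2; auto.
  - rewrite S_INR.
    replace ((2 * (INR j + 1) + 1) * (PI / 2))
      with ((2 * INR j + 1) * (PI / 2) + PI) by field.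
    rewrite neg_cos, neg_sin, IHc, IHs; simpl; split; ring.
Qed.

Lemma is_derive_odd_sin_sum (p n : nat) (x : R) :
  is_derive (odd_sin_sum (S p) n) x (odd_cos_sum p n x).
Proof.
  apply (is_derive_sum_n (fun j y => sin (odd_num j * y) / odd_num j ^ S p)).
  intros j _; pose proof (odd_num_ge1 j).
  assert (odd_num j ^ p <> 0) by (apply pow_nonzero; lra).
  auto_derive; [trivial|]; simpl; field; split; lra.
Qed.

Lemma is_derive_odd_cos_sum (p n : nat) (x : R) :
  is_derive (odd_cos_sum (S p) n) x (- odd_sin_sum p n x).
Proof.
  evar_last.
  - apply (is_derive_sum_n (fun j y => cos (odd_num j * y) / odd_num j ^ S p)
      n x (fun j => (-1) * (sin (odd_num j * x) / odd_num j ^ p))).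
    intros j _; pose proof (odd_num_ge1 j).
    assert (odd_num j ^ p <> 0) by (apply pow_nonzero; lra).
    auto_derive; [trivial|]; simpl; field; split; lra.
  - rewrite (sum_n_mult_l (K := R_Ring) (-1)).
    change (-1 * odd_sin_sum p n x = - odd_sin_sum p n x); ring.
Qed.

Lemma sum_n_S (a : nat -> R) (n : nat) : sum_n a (S n) = sum_n a n + a (S n).
Proof. exact (sum_Sn a n). Qed.

(** A Dirichlet kernel: [2 sin x cos ((2j+1) x) = sin ((2j+2) x) - sin (2j x)], so the sum
    telescopes. *)
Lemma odd_cos_sum_kernel (n : nat) (x : R) :
  2 * sin x * odd_cos_sum 0 n x = sin (2 * (INR n + 1) * x).
Proof.
  unfold odd_cos_sum, odd_num; induction n as [|n IH].
  - rewrite sum_O; simpl (INR 0).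
    replace ((2 * 0 + 1) * x) with x by ring.
    replace (2 * (0 + 1) * x) with (2 * x) by ring.
    rewrite sin_2a; simpl; field.
  - rewrite sum_n_S,  Rmult_plus_distr_l, IH, S_INR.
    replace (2 * (INR n + 1 + 1) * x) with ((2 * (INR n + 1) + 1) * x + x) by ring.
    replace (2 * (INR n + 1) * x) with ((2 * (INR n + 1) + 1) * x - x) by ring.
    rewrite sin_plus, sin_minus; simpl; field.
Qed.

(** Both [g + f] and [g - f] have a nonnegative derivative, so neither decreases from [a] to [b].
    This integrates a pointwise bound on a derivative without introducing integrals. *)
Lemma is_derive_sandwich (f g : R -> R) (df dg : R -> R) (a b : R) :
  a <= b ->
  (forall x, a <= x <= b -> is_derive f x (df x)) ->
  (forall x, a <= x <= b -> is_derive g x (dg x)) ->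
  (forall x, a <= x <= b -> Rabs (df x) <= dg x) ->
  Rabs (f b - f a) <= g b - g a.
Proof.
  intros Hab Hf Hg Hle.
  assert (mono : forall e, (e = 1 \/ e = -1) ->
            0 <= (g b + e * f b) - (g a + e * f a)).
  { intros e He.
    destruct (MVT_gen (fun x => g x + e * f x) a b (fun x => dg x + e * df x))
      as [c [Hc ->]].
    - rewrite Rmin_left, Rmax_right by lra; intros x Hx.
      apply (is_derive_plus g (fun y => e * f y)); [apply Hg; lra|].
      apply (is_derive_scal f); apply Hf; lra.
    - rewrite Rmin_left, Rmax_right by lra; intros x Hx.
      apply continuity_pt_filterlim, (ex_derive_continuous (fun y => g y + e * f y)).
      exists (dg x + e * df x).
      apply (is_derive_plus g (fun y => e * f y)); [apply Hg; lra|].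
      apply (is_derive_scal f); apply Hf; lra.
    - rewrite Rmin_left, Rmax_right in Hc by lra.
      specialize (Hle c Hc).
      apply Rmult_le_pos; [|lra].
      unfold Rabs in Hle; destruct Rcase_abs; destruct He; subst; lra. }
  pose proof (mono 1 (or_introl eq_refl)); pose proof (mono (-1) (or_intror eq_refl)).
  apply Rabs_le; lra.
Qed.

Lemma odd_sin_sum_1_near (n : nat) (x : R) :
  0 < x <= PI / 2 ->
  Rabs (odd_sin_sum 1 n (PI / 2) - odd_sin_sum 1 n x)
    <= / (2 * (INR n + 1) * sin x).
Proof.
  intros Hx; pose proof (pos_INR n) as Hn; pose proof PI_RGT_0.
  set (N := INR n + 1); assert (HN : 1 <= N) by (unfold N; lra).
  assert (Hsin : forall y, x <= y <= PI / 2 -> 0 < sin y)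
    by (intros; apply sin_gt_0; lra).
  assert (Hcos : forall y, x <= y <= PI / 2 -> 0 <= cos y)
    by (intros; apply cos_ge_0; lra).
  (* The oscillating part of [T' = sin (2Ny) / (2 sin y)] is integrated by
     parts: adding [cos (2Ny) / (4N sin y)] leaves a derivative dominated by
     that of [- 1 / (4N sin y)]. *)
  pose proof (is_derive_sandwich
    (fun y => odd_sin_sum 1 n y + cos (2 * N * y) / (4 * N * sin y))
    (fun y => - / (4 * N * sin y))
    (fun y => - (cos (2 * N * y) * cos y) / (4 * N * (sin y)^2))
    (fun y => cos y / (4 * N * (sin y)^2)) x (PI / 2)) as Hmain.
  assert (Rabs (odd_sin_sum 1 n (PI / 2) + cos (2 * N * (PI / 2)) / (4 * N * sin (PI / 2))
    - (odd_sin_sum 1 n x + cos (2 * N * x) / (4 * N * sin x)))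
    <= - / (4 * N * sin (PI / 2)) - - / (4 * N * sin x)) as Hb.
  { apply Hmain; [lra| | |]; intros y Hy; specialize (Hsin y Hy); specialize (Hcos y Hy).
    - evar_last.
      + apply (is_derive_plus (odd_sin_sum 1 n)); [apply is_derive_odd_sin_sum|].
        apply is_derive_Reals; apply is_derive_Reals.
        instantiate (1 := (- (2 * N) * sin (2 * N * y) * (4 * N * sin y)
           - cos (2 * N * y) * (4 * N * cos y)) / (4 * N * sin y) ^ 2).
        auto_derive; [apply Rgt_not_eq; repeat apply Rmult_lt_0_compat; lra|].
        field; split; lra.
      + pose proof (odd_cos_sum_kernel n y) as HK; fold N in HK.
        rewrite <- HK; unfold plus; simpl; field; split; lra.
    - auto_derive; [apply Rgt_not_eq; repeat apply Rmult_lt_0_compat; lra|].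
      field; split; lra.
    - assert (0 < 4 * N * sin y ^ 2)
        by (apply Rmult_lt_0_compat; [lra | apply pow_lt; lra]).
      unfold Rdiv; rewrite Rabs_mult, Rabs_Ropp, Rabs_mult.
      rewrite (Rabs_pos_eq (/ _)) by (left; apply Rinv_0_lt_compat; assumption).
      rewrite (Rabs_pos_eq (cos y)) by assumption.
      apply Rmult_le_compat_r; [left; apply Rinv_0_lt_compat; assumption|].
      assert (Rabs (cos (2 * N * y)) <= 1) by (apply Rabs_le, COS_bound).
      rewrite <- (Rmult_1_l (cos y)) at 2.
      apply Rmult_le_compat_r; lra. }
  rewrite sin_PI2 in Hb.
  pose proof (Hsin x ltac:(lra)) as Hsx.
  assert (Hd : forall a s, -1 <= a <= 1 -> 0 < s ->
             Rabs (a / (4 * N * s)) <= / (4 * N * s)).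
  { intros a s Ha Hs.
    assert (0 < / (4 * N * s))
      by (apply Rinv_0_lt_compat, Rmult_lt_0_compat; lra).
    unfold Rdiv; rewrite Rabs_mult, (Rabs_pos_eq (/ _)) by lra.
    rewrite <- (Rmult_1_l (/ _)) at 2.
    apply Rmult_le_compat_r; [lra | apply Rabs_le; lra]. }
  pose proof (Hd _ 1 (COS_bound (2 * N * (PI / 2))) ltac:(lra)) as H1.
  pose proof (Hd _ _ (COS_bound (2 * N * x)) Hsx) as H2.
  (* The boundary terms cost [1 / (4N)] at [PI / 2] and [1 / (4N sin x)] at [x]. The first cancels
     the [- 1 / (4N)] on the right of [Hb], which leaves twice [1 / (4N sin x)]. *)
  replace (/ (2 * N * sin x)) with (2 * / (4 * N * sin x)) by (field; split; lra).
  apply Rabs_le; apply Rabs_le_between in Hb; apply Rabs_le_between in H1;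
    apply Rabs_le_between in H2; lra.
Qed.

(** Consecutive partial sums of the alternating series bracket [PI / 4], so the error is at most the
    next term [1 / (2n+3)]. *)
Lemma leibniz_rate (n : nat) :
  Rabs (odd_sin_sum 1 n (PI / 2) - PI / 4) <= / (INR n + 1).
Proof.
  pose proof (pos_INR n).
  assert (Hs : forall m, odd_sin_sum 1 m (PI / 2) = sum_f_R0 (tg_alt PI_tg) m).
  { intros m; unfold odd_sin_sum; rewrite <- sum_n_Reals; apply sum_n_ext; intros j.
    rewrite (proj2 (odd_num_half_pi j)); unfold tg_alt, PI_tg, odd_num.
    rewrite plus_INR, mult_INR; simpl; unfold Rdiv; rewrite Rmult_1_r.
    reflexivity. }
  assert (HS : forall m, odd_sin_sum 1 (S m) (PI / 2)
     = odd_sin_sum 1 m (PI / 2) + (-1) ^ S m * / (2 * INR m + 3)).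
  { intros m; unfold odd_sin_sum at 1; rewrite sum_n_S.
    change (odd_sin_sum 1 m (PI/2) + sin (odd_num (S m) * (PI / 2)) / odd_num (S m) ^ 1
     = odd_sin_sum 1 m (PI / 2) + (-1) ^ S m * / (2 * INR m + 3)).
    rewrite (proj2 (odd_num_half_pi (S m))); unfold odd_num; rewrite S_INR.
    unfold Rdiv; do 3 f_equal; ring. }
  assert (Hinv : / (2 * INR n + 3) <= / (INR n + 1)) by (apply Rinv_le_contravar; lra).
  assert (0 < / (INR n + 1)) by (apply Rinv_0_lt_compat; lra).
  destruct (Nat.Even_or_Odd n) as [[m ->]|[m ->]].
  - pose proof (PI_ineq m) as Hm; rewrite <- !Hs in Hm.
    rewrite HS in Hm; rewrite pow_1_odd in Hm; apply Rabs_le; lra.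
  (* For odd [n] the upper bound is the following even partial sum, which belongs to the bracket of
     index [S m]. *)
  - pose proof (PI_ineq m) as Hm; pose proof (PI_ineq (S m)) as Hm'.
    rewrite <- !Hs in Hm, Hm'.
    replace (2 * S m)%nat with (S (2 * m + 1)) in Hm' by lia.
    rewrite (HS (2 * m + 1)%nat) in Hm'.
    replace (S (2 * m)) with (2 * m + 1)%nat in Hm by lia.
    replace (S (2 * m + 1)) with (2 * S m)%nat in Hm' by lia.
    rewrite pow_1_even in Hm'; apply Rabs_le; lra.
Qed.

(** From [x - x^3 / 6 <= sin x]: as [x <= PI / 2 <= 2], the factor [1 - x^2 / 6] is at least
    [1 / 3]. *)
Lemma sin_lower_bound (x : R) : 0 <= x <= PI / 2 -> x / 3 <= sin x.
Proof.
  intros Hx; pose proof PI_4.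
  destruct (pre_sin_bound x 0) as [Hlow _]; [lra|lra|].
  unfold sin_approx, sin_term in Hlow; simpl in Hlow.
  assert (0 <= x * (4 - x * x)) by (apply Rmult_le_pos; nra).
  lra.
Qed.

Definition cubic_remainder (n : nat) (x : R) : R :=
  PI * x * (PI - x) / 8 - odd_sin_sum 3 n x.

Lemma cubic_remainder_le (n : nat) (x : R) :
  0 < x <= PI / 2 ->
  Rabs (cubic_remainder n x) <= / (INR n + 1) * (6 * x + 4 * x / sin x).
Proof.
  intros Hx; pose proof PI_4; pose proof PI_RGT_0; pose proof (pos_INR n).
  set (e := / (INR n + 1)).
  assert (He : 0 < e) by (apply Rinv_0_lt_compat; lra).
  set (R0 := cubic_remainder n).
  set (R1 := fun y => PI * (PI - 2 * y) / 8 - odd_cos_sum 2 n y).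
  set (R2 := fun y => odd_sin_sum 1 n y - PI / 4).
  assert (D0 : forall y, is_derive R0 y (R1 y)).
  { intros y; unfold R0, cubic_remainder, R1.
    apply (is_derive_minus (fun y => PI * y * (PI - y) / 8) (odd_sin_sum 3 n)).
    - auto_derive; [trivial | field].
    - apply is_derive_odd_sin_sum. }
  assert (D1 : forall y, is_derive R1 y (R2 y)).
  { intros y; unfold R1, R2.
    evar_last.
    - apply (is_derive_minus (fun y => PI * (PI - 2 * y) / 8) (odd_cos_sum 2 n)).
      + instantiate (1 := - (PI / 4)); auto_derive; [trivial | field].
      + apply is_derive_odd_cos_sum.
    - unfold minus, plus, opp; simpl; ring. }
  assert (B2 : forall y, 0 < y <= PI / 2 -> Rabs (R2 y) <= e + e / (2 * sin y)).
  { intros y Hy; unfold R2.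
    pose proof (odd_sin_sum_1_near n y Hy) as Ha.
    pose proof (leibniz_rate n) as Hb; fold e in Hb.
    assert (0 < sin y) by (apply sin_gt_0; lra).
    replace (e / (2 * sin y)) with (/ (2 * (INR n + 1) * sin y))
      by (unfold e; field; lra).
    apply Rabs_le; apply Rabs_le_between in Ha; apply Rabs_le_between in Hb; lra. }
  assert (Hsx : 0 < sin x) by (apply sin_gt_0; lra).
  assert (R1half : R1 (PI / 2) = 0).
  { unfold R1, odd_cos_sum.
    rewrite (sum_n_ext _ (fun _ => 0)).
    - rewrite sum_n_const; field.
    - intros j; rewrite (proj1 (odd_num_half_pi j)); apply Rmult_0_l. }
  assert (R00 : R0 0 = 0).
  { unfold R0, cubic_remainder, odd_sin_sum.
    rewrite (sum_n_ext _ (fun _ => 0)).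
    - rewrite sum_n_const; field.
    - intros j; rewrite Rmult_0_r, sin_0; apply Rmult_0_l. }
  (* Sine increases on [[x, PI / 2]], so the bound [B2] is largest at [x] and serves as a constant
     there. *)
  assert (B1 : Rabs (R1 (PI / 2) - R1 x)
           <= (e + e / (2 * sin x)) * (PI / 2) - (e + e / (2 * sin x)) * x).
  { apply (is_derive_sandwich R1 (fun y => (e + e / (2 * sin x)) * y) R2
             (fun _ => e + e / (2 * sin x))).
    - lra.
    - intros; apply D1.
    - intros; auto_derive; [trivial | ring].
    - intros y Hy; eapply Rle_trans; [apply B2; lra|].
      apply Rplus_le_compat_l, Rmult_le_compat_l; [lra|].
      apply Rinv_le_contravar; [lra|].
      apply Rmult_le_compat_l; [lra|].
      apply sin_incr_1; lra. }
  (* [y R1 y - R0 y] has derivative [y R2 y], where the factor [y] absorbs the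
     singularity of the bound on [R2] at [0]. *)
  assert (B0 : Rabs ((x * R1 x - R0 x) - (0 * R1 0 - R0 0)) <= 4 * e * x - 4 * e * 0).
  { apply (is_derive_sandwich (fun y => y * R1 y - R0 y) (fun y => 4 * e * y)
             (fun y => y * R2 y) (fun _ => 4 * e)).
    - lra.
    - intros y _; evar_last.
      + apply (is_derive_minus (fun y => y * R1 y) R0); [|apply D0].
        apply (is_derive_mult (fun y => y) R1); [apply is_derive_id | apply D1 |].
        intros; apply Rmult_comm.
      + unfold minus, plus, opp, mult, one; simpl; ring.
    - intros; auto_derive; [trivial | ring].
    - intros y Hy.
      destruct (Req_dec y 0) as [->|Hy0];
        [rewrite Rmult_0_l, Rabs_R0; lra|].
      assert (0 < sin y) by (apply sin_gt_0; lra).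
      pose proof (sin_lower_bound y ltac:(lra)) as Hlow.
      rewrite Rabs_mult, (Rabs_pos_eq y) by lra.
      eapply Rle_trans; [apply Rmult_le_compat_l; [lra | apply B2; lra]|].
      (* Here [y / sin y <= 3]. Together with [y <= 2] this gives [2 e + 3 / 2 e], below the chosen
         slope [4 e]. *)
      assert (y * (e / (2 * sin y)) <= 3 / 2 * e).
      { replace (y * (e / (2 * sin y))) with (e / 2 * (y / sin y)) by (field; lra).
        replace (3 / 2 * e) with (e / 2 * 3) by field.
        apply Rmult_le_compat_l; [lra|].
        apply (Rmult_le_reg_r (sin y)); [lra|].
        unfold Rdiv; rewrite Rmult_assoc, Rinv_l; lra. }
      nra. }
  rewrite R00 in B0; rewrite R1half in B1.
  (* The length [PI / 2 - x] in [B1] is at most 2, because [PI <= 4]. *)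
  assert (Bx : Rabs (R1 x) <= 2 * e + e / sin x).
  { replace (Rabs (R1 x)) with (Rabs (0 - R1 x))
      by (rewrite <- Rabs_Ropp; f_equal; ring).
    eapply Rle_trans; [exact B1|].
    assert (Hpos : 0 < e / (2 * sin x)) by (apply Rdiv_lt_0_compat; lra).
    replace (e / sin x) with (2 * (e / (2 * sin x))) by (field; lra).
    nra. }
  assert (Bxx : Rabs (x * R1 x) <= 2 * e * x + e * x / sin x).
  { rewrite Rabs_mult, (Rabs_pos_eq x) by lra.
    replace (2 * e * x + e * x / sin x) with (x * (2 * e + e / sin x)) by (field; lra).
    apply Rmult_le_compat_l; lra. }
  assert (0 < x / sin x) by (apply Rdiv_lt_0_compat; lra).
  replace (e * (6 * x + 4 * x / sin x))
    with (6 * (e * x) + 4 * (e * x / sin x)) by (field; lra).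
  assert (0 < e * x / sin x)
    by (apply Rdiv_lt_0_compat; [apply Rmult_lt_0_compat|]; lra).
  apply Rabs_le_between in B0; apply Rabs_le_between in Bxx.
  apply Rabs_le; lra.
Qed.

Lemma odd_sin_sum_PI_sub (p n : nat) (x : R) :
  odd_sin_sum p n (PI - x) = odd_sin_sum p n x.
Proof.
  apply sum_n_ext; intros j; f_equal; unfold odd_num.
  rewrite <- (sin_PI_x ((2 * INR j + 1) * x)).
  replace ((2 * INR j + 1) * (PI - x))
    with (PI - (2 * INR j + 1) * x + 2 * INR j * PI) by ring.
  apply sin_period.
Qed.

(** On [(0, PI / 2]] the remainder is at most a constant depending on [x] divided by [n + 1].
    Reflection in [PI / 2] covers [(PI / 2, PI)], and at both end points, where that constant
    divides by [sin x = 0], all terms vanish. *)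
Lemma odd_sin_sum_cube_lim (x : R) :
  0 <= x <= PI -> is_lim_seq (fun n => odd_sin_sum 3 n x) (PI * x * (PI - x) / 8).
Proof.
  assert (Hhalf : forall x, 0 < x <= PI / 2 ->
    is_lim_seq (fun n => odd_sin_sum 3 n x) (PI * x * (PI - x) / 8)).
  { clear x; intros x Hx.
    set (C := 6 * x + 4 * x / sin x).
    apply is_lim_seq_ext with (fun n => PI * x * (PI - x) / 8 - cubic_remainder n x).
    { intros n; unfold cubic_remainder; ring. }
    replace (PI * x * (PI - x) / 8) with (PI * x * (PI - x) / 8 - 0) at 1 by ring.
    apply is_lim_seq_minus'; [apply is_lim_seq_const|].
    apply is_lim_seq_abs_0.
    apply is_lim_seq_le_le with (fun _ => 0) (fun n => / (INR n + 1) * C).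
    - intros n; split; [apply Rabs_pos | apply cubic_remainder_le, Hx].
    - apply is_lim_seq_const.
    - replace (Finite 0) with (Rbar_mult (Rbar_inv p_infty) C)
        by (simpl; f_equal; ring).
      apply is_lim_seq_scal_r, is_lim_seq_inv; [|discriminate].
      apply is_lim_seq_ext with (fun n => INR (S n)); [intros; apply S_INR|].
      apply (is_lim_seq_incr_1 INR), is_lim_seq_INR. }
  intros Hx; pose proof PI_RGT_0.
  destruct (Req_dec x 0) as [->|H0]; [|destruct (Req_dec x PI) as [->|H1];
    [|destruct (Rle_dec x (PI / 2))]].
  - apply is_lim_seq_ext with (fun _ => 0).
    + intros n; unfold odd_sin_sum; rewrite (sum_n_ext _ (fun _ => 0)).
      * rewrite sum_n_const; ring.
      * intros j; rewrite Rmult_0_r, sin_0; apply Rmult_0_l.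
    + replace (PI * 0 * (PI - 0) / 8) with 0 by field; apply is_lim_seq_const.
  - apply is_lim_seq_ext with (fun _ => 0).
    + intros n; rewrite <- odd_sin_sum_PI_sub.
      unfold odd_sin_sum; rewrite (sum_n_ext _ (fun _ => 0)).
      * rewrite sum_n_const; ring.
      * intros j; rewrite Rminus_diag, Rmult_0_r, sin_0; apply Rmult_0_l.
    + replace (PI * PI * (PI - PI) / 8) with 0 by field; apply is_lim_seq_const.
  - apply Hhalf; lra.
  - apply is_lim_seq_ext with (fun n => odd_sin_sum 3 n (PI - x)).
    + intros m; apply odd_sin_sum_PI_sub.
    + replace (PI * x * (PI - x) / 8) with (PI * (PI - x) * (PI - (PI - x)) / 8)
        by (field; lra).
      apply Hhalf; lra.
Qed.

Lemma parabola_sine_series (nu h p10 z : R) :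
  0 < nu -> 0 < h -> 0 <= z <= h ->
  is_series (fun n : nat =>
        let k := S n in
        2 * p10 * h ^ 2 / (nu * (INR k * PI) ^ 3) * ((-1) ^ k - 1)
        * sin (PI * INR k * z / h)) (- (p10 / (2 * nu)) * z * (h - z)).
Proof.
  intros Hnu Hh Hz; pose proof PI_RGT_0.
  set (a := fun n : nat => _).
  (* The factor [(-1)^k - 1] is [-2] for odd [k] and 0 for even [k]; [c] collects what does not
     depend on [k] in the odd terms. *)
  set (c := - (4 * p10 * h ^ 2 / (nu * PI ^ 3))).
  set (x := PI * z / h).
  assert (Hx : 0 <= x <= PI).
  { unfold x; split.
    - apply Rdiv_le_0_compat; [nra | lra].
    - apply (Rmult_le_reg_r h); [lra|].
      unfold Rdiv; rewrite Rmult_assoc, Rinv_l by lra; nra. }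
  assert (Hval : - (p10 / (2 * nu)) * z * (h - z)
            = c * (PI * x * (PI - x) / 8) + 1 * 0).
  { unfold c, x; field; repeat split; lra. }
  rewrite Hval.
  (* The series is split by parity as a power series evaluated at 1, whose two halves are power
     series at [1 ^ 2]. Since [k = S n], the nonzero terms sit at even [n]. *)
  assert (Hone : forall (j : nat) (y : R), scal (pow_n (1 ^ 2) j) y = y).
  { intros j y; change (pow_n (1 ^ 2) j * y = y).
    rewrite (pow_n_pow (1 ^ 2) j), !pow1; ring. }
  assert (Heven : forall j, a (2 * j)%nat = c * (sin (odd_num j * x) / odd_num j ^ 3)).
  { intros j; unfold a; cbv zeta; rewrite pow_1_odd.
    replace (INR (S (2 * j))) with (odd_num j)
      by (rewrite S_INR, mult_INR; simpl; unfold odd_num; ring).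
    pose proof (odd_num_ge1 j).
    replace (PI * odd_num j * z / h) with (odd_num j * x) by (unfold x; field; lra).
    unfold c; field; repeat split; lra. }
  assert (Hodd : forall j, a (2 * j + 1)%nat = 0).
  { intros j; unfold a; cbv zeta.
    replace (S (2 * j + 1)) with (2 * S j)%nat by lia.
    rewrite pow_1_even; ring. }
  assert (Hp : is_pseries a 1 (c * (PI * x * (PI - x) / 8) + 1 * 0)).
  { apply (is_pseries_odd_even a 1).
    - apply (is_series_ext (fun j => c * (sin (odd_num j * x) / odd_num j ^ 3))).
      + intros j; rewrite Hone; apply eq_sym, Heven.
      + apply (is_series_scal_l c (fun j => sin (odd_num j * x) / odd_num j ^ 3)).
        apply odd_sin_sum_cube_lim, Hx.
    - apply (is_series_ext (fun _ => 0)).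
      + intros j; rewrite Hone; apply eq_sym, Hodd.
      + change (is_lim_seq (sum_n (fun _ => 0)) 0).
        apply is_lim_seq_ext with (fun _ => 0); [|apply is_lim_seq_const].
        intros n; rewrite sum_n_const; ring. }
  apply is_series_ext with (2 := Hp).
  intros n; rewrite <- (pow1 2); apply Hone.
Qed.

(** * Integrals depending on parameters *)

Definition continuous2 (f : R -> R -> R) : Prop :=
  forall q : R * R, continuous (fun q => f (fst q) (snd q)) q.

Definition continuous3 (f : R -> R -> R -> R) : Prop :=
  forall q : R * R * R,
    continuous (fun q => f (fst (fst q)) (snd (fst q)) (snd q)) q.

Lemma continuous_pair {T U V : UniformSpace} (f : T -> U) (g : T -> V) (x : T) :
  continuous f x -> continuous g x -> continuous (fun y => (f y, g y)) x.
Proof.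
  intros Hf Hg; apply filterlim_locally; intros eps.
  apply filter_and; [apply (proj1 (filterlim_locally f (f x)) Hf)
                    |apply (proj1 (filterlim_locally g (g x)) Hg)].
Qed.

Lemma continuous2_comp {T : UniformSpace} (f : R -> R -> R) (a b : T -> R) (x : T) :
  continuous2 f -> continuous a x -> continuous b x ->
  continuous (fun y => f (a y) (b y)) x.
Proof.
  intros Hf Ha Hb.
  apply (continuous_comp (fun y => (a y, b y)) (fun q => f (fst q) (snd q)));
    [apply continuous_pair; assumption | apply Hf].
Qed.

Lemma continuous3_comp {T : UniformSpace} (f : R -> R -> R -> R)
    (a b c : T -> R) (x : T) :
  continuous3 f -> continuous a x -> continuous b x -> continuous c x ->
  continuous (fun y => f (a y) (b y) (c y)) x.
Proof.
  intros Hf Ha Hb Hc.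
  apply (continuous_comp (fun y => ((a y, b y), c y))
           (fun q => f (fst (fst q)) (snd (fst q)) (snd q)));
    [repeat apply continuous_pair; assumption | apply Hf].
Qed.

Lemma is_RInt_everywhere_continuous (f : R -> R) (a b : R) :
  (forall x, continuous f x) -> is_RInt f a b (RInt f a b).
Proof.
  intros Hf; apply (RInt_correct (V := R_CompleteNormedModule)).
  apply (ex_RInt_continuous (V := R_CompleteNormedModule)); intros; apply Hf.
Qed.

Lemma ex_RInt_everywhere_continuous (f : R -> R) (a b : R) :
  (forall x, continuous f x) -> ex_RInt f a b.
Proof. intros Hf; eexists; apply is_RInt_everywhere_continuous, Hf. Qed.

(** Compactness of [[a, b]]: joint continuity gives a radius around each [(p, z)], and finitely many
    of them cover the segment. Both values are compared with the one at a centre [t], hence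
    [eps / 2]. *)
Lemma locally_uniform_on_segment {T : UniformSpace} (F : T -> R -> R) (a b : R) (p : T) (eps : posreal) :
  (forall q : T * R, continuous (fun q => F (fst q) (snd q)) q) ->
  locally p (fun p' => forall z, a <= z <= b -> Rabs (F p' z - F p z) < eps).
Proof.
  intros HF.
  assert (Hd : forall z, {d : posreal | forall p' z', ball p d p' ->
            Rabs (z' - z) < d -> Rabs (F p' z' - F p z) < eps / 2}).
  { intros z; apply constructive_indefinite_description.
    destruct (proj1 (filterlim_locally _ _) (HF (p, z))
      (mkposreal (eps / 2) (is_pos_div_2 eps))) as [d Hd].
    exists d; intros p' z' Hp Hz; apply (Hd (p', z')); split; assumption. }
  destruct (compactness_value_1d a b (fun z => proj1_sig (Hd z))) as [d Hc].
  exists d; intros p' Hp z Hz.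
  (* [compactness_value_1d] yields its centre under a double negation; deciding the goal first makes
     it available. *)
  destruct (Rlt_dec (Rabs (F p' z - F p z)) eps) as [|Hn]; [assumption|].
  exfalso; apply (Hc z Hz); intros [t [_ [Hzt Hdt]]]; apply Hn.
  destruct (Hd t) as [dt Ht]; simpl in *.
  pose proof (Ht p' z (ball_le p _ _ Hdt _ Hp) Hzt) as H1.
  pose proof (Ht p z (ball_center p dt) Hzt) as H2.
  apply Rabs_lt_between in H1; apply Rabs_lt_between in H2.
  apply Rabs_lt_between; lra.
Qed.

Lemma continuous_RInt_param {T : UniformSpace} (F : T -> R -> R) (a b : R) (p : T) :
  a <= b ->
  (forall q : T * R, continuous (fun q => F (fst q) (snd q)) q) ->
  continuous (fun p => RInt (F p) a b) p.
Proof.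
  intros Hab HF.
  assert (Hex : forall p, ex_RInt (F p) a b).
  { intros p'; apply ex_RInt_everywhere_continuous; intros z.
    apply (continuous_comp (fun z => (p', z)) (fun q => F (fst q) (snd q)));
      [apply continuous_pair; [apply continuous_const | apply continuous_id] | apply HF]. }
  apply filterlim_locally; intros eps.
  (* The added 1 keeps the quotient meaningful when [a = b] and makes the final inequality
     strict. *)
  assert (Hpos : 0 < eps / (b - a + 1))
    by (apply Rdiv_lt_0_compat; [apply cond_pos | lra]).
  eapply filter_imp; [|apply (locally_uniform_on_segment F a b p (mkposreal _ Hpos) HF)].
  intros p' Hp; simpl in Hp.
  change (Rabs (RInt (F p') a b - RInt (F p) a b) < eps).
  assert (Hm : is_RInt (fun z => F p' z - F p z) a b (RInt (F p') a b - RInt (F p) a b)).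
  { apply (is_RInt_minus (F p') (F p)); apply (RInt_correct (V := R_CompleteNormedModule)), Hex. }
  rewrite <- (is_RInt_unique _ _ _ _ Hm).
  apply Rle_lt_trans with ((b - a) * (eps / (b - a + 1))).
  - apply abs_RInt_le_const; [exact Hab | eexists; exact Hm|].
    intros z Hz; left; apply Hp, Hz.
  - pose proof (cond_pos eps).
    replace (pos eps) with ((b - a + 1) * (eps / (b - a + 1))) at 2 by (field; lra).
    apply Rmult_lt_compat_r; lra.
Qed.

Lemma is_derive_RInt_continuous2 (f df : R -> R -> R) (a b x : R) :
  (forall x z, is_derive (fun x => f x z) x (df x z)) ->
  continuous2 f -> continuous2 df ->
  is_derive (fun x => RInt (f x) a b) x (RInt (df x) a b).
Proof.
  intros Hd Hf Hdf.
  assert (HD : forall x z, Derive (fun u => f u z) x = df x z)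
    by (intros; apply is_derive_unique, Hd).
  rewrite <- (RInt_ext (fun z => Derive (fun u => f u z) x)) by (intros; apply HD).
  apply (is_derive_RInt_param f).
  - apply filter_forall; intros y z _; eexists; apply Hd.
  - intros z _; apply continuity_2d_pt_ext with df; [intros; symmetry; apply HD|].
    apply continuity_2d_pt_filterlim, (Hdf (x, z)).
  - apply filter_forall; intros y; apply ex_RInt_everywhere_continuous; intros z.
    apply (continuous2_comp f (fun _ => y) (fun z => z));
      [exact Hf | apply continuous_const | apply continuous_id].
Qed.

(** The fundamental theorem with the derivative known only inside, as for the [z]-derivatives of
    fields frozen beyond the walls. The difference between [f] and a primitive of [df] is continuous
    with zero derivative inside, hence has equal values at [a] and [b]. *)
Lemma RInt_derive_open (f df : R -> R) (a b : R) :
  a < b ->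
  (forall x, continuous f x) -> (forall x, continuous df x) ->
  (forall x, a < x < b -> is_derive f x (df x)) ->
  is_RInt df a b (f b - f a).
Proof.
  intros Hab Hf Hdf Hd.
  set (I := fun x => RInt df a x).
  assert (HI : forall x, is_RInt df a x (I x)).
  { intros x; apply is_RInt_everywhere_continuous, Hdf. }
  assert (DI : forall x, is_derive I x (df x)).
  { intros x; apply (is_derive_RInt df I a x); [|apply Hdf].
    apply filter_forall; intros; apply HI. }
  destruct (MVT_gen (fun x => f x - I x) a b (fun _ => 0)) as [c [_ Hc]].
  - rewrite Rmin_left, Rmax_right by lra; intros x Hx.
    replace 0 with (df x - df x) by ring.
    apply (is_derive_minus f I); [apply Hd, Hx | apply DI].
  - intros x _; apply continuity_pt_filterlim.
    apply (continuous_minus f I); [apply Hf|].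
    apply (ex_derive_continuous I); eexists; apply DI.
  - assert (Ia : I a = 0) by (apply (RInt_point a df)).
    replace (f b - f a) with (I b) by lra.
    apply HI.
Qed.

Lemma RInt_zero_continuous (f : R -> R) (a b x : R) :
  (forall y, continuous f y) -> (forall y, a <= y <= b -> 0 <= f y) ->
  a < b -> RInt f a b <= 0 -> a <= x <= b -> f x = 0.
Proof.
  intros Hf Hpos Hab HI Hx.
  destruct (Req_dec (f x) 0) as [|Hne]; [assumption|exfalso].
  assert (Hfx : 0 < f x) by (specialize (Hpos x Hx); lra).
  destruct (proj1 (filterlim_locally f (f x)) (Hf x) (mkposreal _ Hfx)) as [d Hd].
  pose proof (cond_pos d).
  (* A neighbourhood of [x] on which [f] stays positive, clipped to [[a, b]]; it is nondegenerate
     even if [x] is an end point. *)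
  set (l := Rmax a (x - d / 2)); set (r := Rmin b (x + d / 2)).
  assert (Hl : a <= l /\ x - d / 2 <= l /\ l <= x).
  { unfold l; repeat split; [apply Rmax_l | apply Rmax_r | apply Rmax_lub; lra]. }
  assert (Hr : r <= b /\ r <= x + d / 2 /\ x <= r).
  { unfold r; repeat split; [apply Rmin_l | apply Rmin_r | apply Rmin_glb; lra]. }
  assert (Hlr : l < r).
  { unfold l, r; apply Rmax_lub_lt; apply Rmin_glb_lt; lra. }
  assert (Hex : forall u v, ex_RInt f u v)
    by (intros; apply ex_RInt_everywhere_continuous, Hf).
  assert (H1 : 0 <= RInt f a l)
    by (apply RInt_ge_0; [lra | apply Hex | intros; apply Hpos; lra]).
  assert (H2 : 0 <= RInt f r b)
    by (apply RInt_ge_0; [lra | apply Hex | intros; apply Hpos; lra]).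
  assert (H3 : 0 < RInt f l r).
  { apply RInt_gt_0; [exact Hlr | | intros; apply Hf].
    intros y Hy.
    assert (Hb : Rabs (f y - f x) < f x).
    { apply (Hd y); change (Rabs (y - x) < d); apply Rabs_lt_between; lra. }
    apply Rabs_lt_between in Hb; lra. }
  pose proof (RInt_Chasles f a l r (Hex _ _) (Hex _ _)) as C1.
  pose proof (RInt_Chasles f a r b (Hex _ _) (Hex _ _)) as C2.
  unfold plus in C1, C2; simpl in C1, C2; lra.
Qed.

Lemma periodic_fundamental_domain (f : R -> R) (L : R) :
  0 < L -> (forall y, f (y + L) = f y) ->
  forall y, exists y', 0 <= y' <= L /\ f y = f y'.
Proof.
  intros HL Hf.
  assert (Hn : forall n y, f (y + INR n * L) = f y).
  { induction n as [|n IH]; intros y; [simpl; f_equal; ring|].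
    rewrite S_INR; replace (y + (INR n + 1) * L) with ((y + INR n * L) + L) by ring.
    rewrite Hf; apply IH. }
  intros y; destruct (Rle_dec 0 y) as [Hy|Hy].
  - destruct (nfloor_ex (y / L)) as [n Hfl]; [apply Rdiv_le_0_compat; lra|].
    assert (Hq : y / L * L = y) by (field; lra).
    exists (y - INR n * L); split; [nra|].
    rewrite <- (Hn n (y - INR n * L)); f_equal; ring.
  (* For negative [y] the floor of [- y / L] falls short of reaching [[0, L]] by up to one period,
     so [S n] periods are added. *)
  - destruct (nfloor_ex (- y / L)) as [n Hfl]; [apply Rdiv_le_0_compat; lra|].
    assert (Hq : - y / L * L = - y) by (field; lra).
    exists (y + INR (S n) * L); split; [rewrite S_INR; nra|].
    symmetry; apply Hn.
Qed.

(** [exp (c t) G t] is nonincreasing, so a positive value [G t] forces [G (t - x) >= exp (c x) G t >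
    (1 + c x) G t]. The choice [x = M / (c G t)] makes [c x G t = M] and contradicts the bound. *)
Lemma ancient_decay_zero (G dG : R -> R) (c M : R) :
  0 < c -> (forall t, is_derive G t (dG t)) -> (forall t, dG t <= - c * G t) ->
  (forall t, 0 <= G t <= M) -> forall t, G t = 0.
Proof.
  intros Hc HG Hle Hb t.
  destruct (Req_dec (G t) 0) as [|Hne]; [assumption|exfalso].
  assert (Ht : 0 < G t) by (specialize (Hb t); lra).
  set (x := M / (c * G t)).
  assert (HM : 0 < M) by (specialize (Hb t); lra).
  assert (Hx : 0 < x) by (apply Rdiv_lt_0_compat; [|apply Rmult_lt_0_compat]; lra).
  assert (D : forall s, is_derive (fun s => exp (c * s) * G s) s
                 (exp (c * s) * (c * G s + dG s))).
  { intros s; evar_last.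
    - apply (is_derive_mult (fun s => exp (c * s)) G); [|apply HG|intros; apply Rmult_comm].
      instantiate (1 := c * exp (c * s)); auto_derive; [trivial | ring].
    - unfold plus, mult; simpl; ring. }
  destruct (MVT_gen (fun s => exp (c * s) * G s) (t - x) t
    (fun s => exp (c * s) * (c * G s + dG s))) as [s [_ Hs]].
  - intros; apply D.
  - intros; apply continuity_pt_filterlim.
    apply (ex_derive_continuous (fun s => exp (c * s) * G s)); eexists; apply D.
  - assert (Hneg : exp (c * s) * (c * G s + dG s) * (t - (t - x)) <= 0).
    { pose proof (exp_pos (c * s)); specialize (Hle s).
      assert (exp (c * s) * (c * G s + dG s) <= 0) by nra.
      nra. }
    assert (He : exp (c * t) = exp (c * (t - x)) * exp (c * x))
      by (rewrite <- exp_plus; f_equal; ring).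
    rewrite He in Hs.
    pose proof (exp_pos (c * (t - x))).
    assert (Hex : exp (c * x) * G t <= G (t - x)).
    { apply (Rmult_le_reg_l (exp (c * (t - x)))); [assumption|]; lra. }
    pose proof (exp_ineq1 (c * x) ltac:(nra)).
    destruct (Hb (t - x)).
    assert (c * x * G t = M) by (unfold x; field; split; lra).
    nra.
Qed.

(** * Bounded ancient solutions of the heat equation in a strip *)

Lemma continuous_fst_any {U V : UniformSpace} (q : U * V) : continuous fst q.
Proof. destruct q; apply continuous_fst. Qed.

Lemma continuous_snd_any {U V : UniformSpace} (q : U * V) : continuous snd q.
Proof. destruct q; apply continuous_snd. Qed.

Definition clamp (h z : R) : R := Rmax 0 (Rmin z h).

Lemma clamp_bounds (h z : R) : 0 < h -> 0 <= clamp h z <= h.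
Proof. unfold clamp, Rmax, Rmin; intros; repeat destruct Rle_dec; lra. Qed.

Lemma clamp_id (h z : R) : 0 <= z <= h -> clamp h z = z.
Proof. unfold clamp, Rmax, Rmin; intros; repeat destruct Rle_dec; lra. Qed.

Lemma continuous_clamp (h z : R) : continuous (clamp h) z.
Proof.
  apply filterlim_locally; intros eps; exists eps; intros y Hy.
  change (Rabs (clamp h y - clamp h z) < eps); change (Rabs (y - z) < eps) in Hy.
  apply Rle_lt_trans with (2 := Hy).
  unfold clamp, Rmax, Rmin; repeat destruct Rle_dec; unfold Rabs;
    repeat destruct Rcase_abs; lra.
Qed.

Ltac solve_continuous :=
  repeat first
    [ apply continuous_const
    | apply continuous_id
    | match goal with
      | H : continuous3 ?f |- continuous (fun q => ?f (@?a q) (@?b q) (@?c q)) _ =>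
          apply (continuous3_comp f a b c); [exact H | | |]
      | |- continuous (fun q => @?u q * @?v q) _ => apply (continuous_mult u v)
      | |- continuous (fun q => @?u q + @?v q) _ => apply (continuous_plus u v)
      | |- continuous (fun q => @?u q - @?v q) _ => apply (continuous_minus u v)
      | |- continuous (fun q => fst (@?u q)) _ =>
          apply (continuous_comp u fst); [|apply continuous_fst_any]
      | |- continuous (fun q => snd (@?u q)) _ =>
          apply (continuous_comp u snd); [|apply continuous_snd_any]
      | |- continuous (fun q => sin (@?u q)) _ =>
          apply (continuous_comp u sin); [|apply continuous_sin]
      | |- continuous (fun q => cos (@?u q)) _ =>
          apply (continuous_comp u cos); [|apply continuous_cos]
      | |- continuous (fun q => clamp ?h (@?u q)) _ =>
          apply (continuous_comp u (clamp h)); [|apply continuous_clamp]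
      end ].

(** The derivatives are given as functions continuous on the whole space, while the [z]-derivatives
    and the equation are tied to [w] only between the walls: this is what fields frozen outside the
    channel satisfy. With [z] as last argument, [f y t] is directly the integrand across the
    strip. *)
Lemma heat_ancient_zero (nu h L M : R) (w wt wy wyy wz wzz : R -> R -> R -> R) :
  0 < nu -> 0 < h -> 0 < L ->
  continuous3 w -> continuous3 wt -> continuous3 wy -> continuous3 wyy ->
  continuous3 wz -> continuous3 wzz ->
  (forall y t z, is_derive (fun t => w y t z) t (wt y t z)) ->
  (forall y t z, is_derive (fun y => w y t z) y (wy y t z)) ->
  (forall y t z, is_derive (fun y => wy y t z) y (wyy y t z)) ->
  (forall y t z, 0 < z < h -> is_derive (fun z => w y t z) z (wz y t z)) ->
  (forall y t z, 0 < z < h -> is_derive (fun z => wz y t z) z (wzz y t z)) ->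
  (forall y t z, 0 < z < h -> wt y t z = nu * (wyy y t z + wzz y t z)) ->
  (forall y t, w y t 0 = 0 /\ w y t h = 0) ->
  (forall y t z, w (y + L) t z = w y t z) ->
  (forall t, RInt (fun y => RInt (fun z => w y t z * w y t z) 0 h) 0 L <= M) ->
  forall y t z, 0 <= z <= h -> w y t z = 0.
Proof.
  intros Hnu Hh HL Cw Cwt Cwy Cwyy Cwz Cwzz Dt Dy Dyy Dz Dzz Heq Hbd Hper HM.
  pose proof PI_RGT_0.
  (* Weighting the energy by [sin (k z)], positive on [(0, h)], replaces the
     Poincare inequality: [w w_zz] is integrated by parts twice onto the weight. *)
  set (k := PI / h).
  assert (Hk : 0 < k) by (apply Rdiv_lt_0_compat; lra).
  assert (Hkh : k * h = PI) by (unfold k; field; lra).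
  set (c := nu * k ^ 2).
  assert (Hc : 0 < c) by (apply Rmult_lt_0_compat; [|apply pow_lt]; lra).
  assert (Hphi : forall z, 0 <= z <= h -> 0 <= sin (k * z)).
  { intros z Hz; apply sin_ge_0; [nra|]; rewrite <- Hkh; nra. }
  assert (Hphi' : forall z, 0 < z < h -> 0 < sin (k * z)).
  { intros z Hz; apply sin_gt_0; [nra|]; rewrite <- Hkh; nra. }
  set (e := fun y t z => w y t z * w y t z * sin (k * z)).
  set (et := fun y t z => 2 * w y t z * wt y t z * sin (k * z)).
  set (ey := fun y t z => 2 * w y t z * wy y t z * sin (k * z)).
  set (eyy := fun y t z =>
    2 * (wy y t z * wy y t z + w y t z * wyy y t z) * sin (k * z)).
  (* With [phi z = sin (k z)], [flux] is [(w^2)_z phi - w^2 phi_z]. Its [z]-derivative is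
     [(w^2)_zz phi - w^2 phi_zz], and [phi_zz = - k^2 phi]; since [w] vanishes on the walls, so does
     [flux]. *)
  set (flux := fun y t z =>
    2 * w y t z * wz y t z * sin (k * z) - w y t z * w y t z * (k * cos (k * z))).
  set (dflux := fun y t z =>
    2 * (wz y t z * wz y t z + w y t z * wzz y t z) * sin (k * z)
    + k ^ 2 * (w y t z * w y t z * sin (k * z))).
  assert (Ce : continuous3 e) by (intros q; unfold e; solve_continuous).
  assert (Cet : continuous3 et) by (intros q; unfold et; solve_continuous).
  assert (Cey : continuous3 ey) by (intros q; unfold ey; solve_continuous).
  assert (Ceyy : continuous3 eyy) by (intros q; unfold eyy; solve_continuous).
  assert (Cflux : continuous3 flux) by (intros q; unfold flux; solve_continuous).
  assert (Cdflux : continuous3 dflux) by (intros q; unfold dflux; solve_continuous).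
  assert (Cz : forall f y t z, continuous3 f -> continuous (f y t) z)
    by (intros f y t z Hf; apply (continuous3_comp f (fun _ => y) (fun _ => t) (fun z => z));
        [exact Hf | solve_continuous ..]).
  set (int := fun (f : R -> R -> R -> R) y t => RInt (f y t) 0 h).
  assert (Cint : forall f, continuous3 f -> continuous2 (int f)).
  { intros f Hf q; unfold int.
    apply (continuous_RInt_param (fun q => f (fst q) (snd q))); [lra|].
    intros r; solve_continuous. }
  assert (Iint : forall f y t, continuous3 f -> is_RInt (f y t) 0 h (int f y t)).
  { intros f y t Hf; apply is_RInt_everywhere_continuous; intros z; apply Cz, Hf. }
  assert (Gt : forall y t, is_derive (int e y) t (int et y t)).
  { intros y t; apply (is_derive_RInt_continuous2 (fun t z => e y t z) (fun t z => et y t z)).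
    - intros s z; unfold e, et.
      evar_last.
      + apply (is_derive_mult (fun s => w y s z * w y s z) (fun _ => sin (k * z)));
          [|apply is_derive_const | intros; apply Rmult_comm].
        apply (is_derive_mult (fun s => w y s z) (fun s => w y s z));
          [apply Dt | apply Dt | intros; apply Rmult_comm].
      + unfold plus, mult, zero; simpl; ring.
    - intros q; solve_continuous.
    - intros q; solve_continuous. }
  assert (Gy : forall y t, is_derive (fun y => int e y t) y (int ey y t)).
  { intros y t; apply (is_derive_RInt_continuous2 (fun y z => e y t z) (fun y z => ey y t z)).
    - intros s z; unfold e, ey.
      evar_last.
      + apply (is_derive_mult (fun s => w s t z * w s t z) (fun _ => sin (k * z)));
          [|apply is_derive_const | intros; apply Rmult_comm].
        apply (is_derive_mult (fun s => w s t z) (fun s => w s t z));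
          [apply Dy | apply Dy | intros; apply Rmult_comm].
      + unfold plus, mult, zero; simpl; ring.
    - intros q; solve_continuous.
    - intros q; solve_continuous. }
  assert (Gyy : forall y t, is_derive (fun y => int ey y t) y (int eyy y t)).
  { intros y t; apply (is_derive_RInt_continuous2 (fun y z => ey y t z) (fun y z => eyy y t z)).
    - intros s z; unfold ey, eyy.
      evar_last.
      + apply (is_derive_mult (fun s => 2 * w s t z * wy s t z) (fun _ => sin (k * z)));
          [|apply is_derive_const | intros; apply Rmult_comm].
        apply (is_derive_mult (fun s => 2 * w s t z) (fun s => wy s t z));
          [apply is_derive_scal, Dy | apply Dyy | intros; apply Rmult_comm].
      + unfold plus, mult, zero; simpl; ring.
    - intros q; solve_continuous.
    - intros q; solve_continuous. }
  assert (Idflux : forall y t, is_RInt (dflux y t) 0 h 0).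
  { intros y t; evar_last.
    - apply (RInt_derive_open (flux y t) (dflux y t)); [exact Hh | | |].
      + intros z; apply Cz, Cflux.
      + intros z; apply Cz, Cdflux.
      + intros z Hz; unfold flux, dflux; evar_last.
        * apply (is_derive_minus (fun z => 2 * w y t z * wz y t z * sin (k * z))
            (fun z => w y t z * w y t z * (k * cos (k * z)))).
          -- apply (is_derive_mult (fun z => 2 * w y t z * wz y t z) (fun z => sin (k * z)));
               [| |intros; apply Rmult_comm].
             ++ apply (is_derive_mult (fun z => 2 * w y t z) (fun z => wz y t z));
                  [apply is_derive_scal, Dz, Hz | apply Dzz, Hz | intros; apply Rmult_comm].
             ++ instantiate (1 := k * cos (k * z)); auto_derive; [trivial | ring].
          -- apply (is_derive_mult (fun z => w y t z * w y t z) (fun z => k * cos (k * z)));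
               [| |intros; apply Rmult_comm].
             ++ apply (is_derive_mult (fun z => w y t z) (fun z => w y t z));
                  [apply Dz, Hz | apply Dz, Hz | intros; apply Rmult_comm].
             ++ instantiate (1 := - k ^ 2 * sin (k * z)); auto_derive; [trivial | ring].
        * unfold minus, plus, mult, opp; simpl; ring.
    - unfold flux; destruct (Hbd y t) as [-> ->]; ring. }
  (* By the equation, [nu eyy + nu dflux - c e] exceeds [et] by exactly
     [2 nu (wy^2 + wz^2) sin (k z)], which is nonnegative, and [dflux] integrates to 0. *)
  assert (Hineq : forall y t, int et y t <= nu * int eyy y t - c * int e y t).
  { intros y t.
    pose proof (is_RInt_minus _ _ _ _ _ _
      (is_RInt_plus _ _ _ _ _ _
         (is_RInt_scal _ _ _ nu _ (Iint eyy y t Ceyy))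
         (is_RInt_scal _ _ _ nu _ (Idflux y t)))
      (is_RInt_scal _ _ _ c _ (Iint e y t Ce))) as Hr.
    replace (nu * int eyy y t - c * int e y t)
      with (nu * int eyy y t + nu * 0 - c * int e y t) by ring.
    refine (is_RInt_le _ _ _ _ _ _ _ (Iint et y t Cet) Hr _); [lra|].
    intros z Hz; unfold minus, plus, opp, scal, mult; simpl; unfold mult; simpl.
    unfold et, eyy, dflux, e, c; rewrite (Heq y t z Hz).
    pose proof (Hphi' z Hz) as Hp.
    assert (0 <= nu * (wy y t z * wy y t z + wz y t z * wz y t z) * sin (k * z)).
    { apply Rmult_le_pos; [apply Rmult_le_pos; [lra|]; nra | lra]. }
    lra. }
  assert (Hwyper : forall y t z, wy (y + L) t z = wy y t z).
  { intros y t z.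
    rewrite <- (is_derive_unique _ _ _ (Dy y t z)).
    symmetry; apply is_derive_unique.
    apply is_derive_ext with (fun y => w (y + L) t z); [intros; apply Hper|].
    evar_last.
    - apply (is_derive_comp (fun y => w y t z) (fun y => y + L)); [apply Dy|].
      instantiate (1 := 1); auto_derive; [trivial | ring].
    - unfold scal; simpl; unfold mult; simpl; ring. }
  assert (Cslice : forall f t y, continuous3 f -> continuous (fun y => int f y t) y).
  { intros f t y Hf.
    apply (continuous2_comp (int f) (fun y => y) (fun _ => t));
      [apply Cint, Hf | solve_continuous ..]. }
  set (G := fun t => RInt (fun y => int e y t) 0 L).
  set (dG := fun t => RInt (fun y => int et y t) 0 L).
  assert (IG : forall f t, continuous3 f ->
     is_RInt (fun y => int f y t) 0 L (RInt (fun y => int f y t) 0 L)).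
  { intros f t Hf; apply is_RInt_everywhere_continuous; intros y; apply Cslice, Hf. }
  assert (DG : forall t, is_derive G t (dG t)).
  { intros t; apply (is_derive_RInt_continuous2 (fun t y => int e y t) (fun t y => int et y t)).
    - intros; apply Gt.
    - intros q; apply (continuous2_comp (int e) (fun q => snd q) (fun q => fst q));
        [apply Cint, Ce | solve_continuous ..].
    - intros q; apply (continuous2_comp (int et) (fun q => snd q) (fun q => fst q));
        [apply Cint, Cet | solve_continuous ..]. }
  assert (Hdecay : forall t, dG t <= - c * G t).
  { intros t.
    (* Periodicity of [w] and [wy] makes the end values of [int ey] cancel. *)
    assert (Hyy : is_RInt (fun y => int eyy y t) 0 L 0).
    { evar_last.
      - apply (is_RInt_derive (fun y => int ey y t) (fun y => int eyy y t)).
        + intros; apply Gyy.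
        + intros; apply Cslice, Ceyy.
      - assert (E : int ey L t = int ey 0 t).
        { apply RInt_ext; intros z _; unfold ey.
          replace L with (0 + L) by ring; rewrite Hper, Hwyper; reflexivity. }
        rewrite E; unfold minus, plus, opp; simpl; ring. }
    pose proof (is_RInt_minus _ _ _ _ _ _
      (is_RInt_scal _ _ _ nu _ Hyy) (is_RInt_scal _ _ _ c _ (IG e t Ce))) as Hr.
    replace (- c * G t) with (nu * 0 - c * G t) by ring.
    refine (is_RInt_le _ _ _ _ _ _ _ (IG et t Cet) Hr _); [lra|].
    intros y _; apply Hineq. }
  assert (Hpos : forall y t, 0 <= int e y t).
  { intros y t; apply RInt_ge_0; [lra | eexists; apply Iint, Ce|].
    intros z Hz; unfold e; apply Rmult_le_pos; [nra | apply Hphi; lra]. }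
  set (w2 := fun y t z => w y t z * w y t z).
  assert (Cw2 : continuous3 w2) by (intros q; unfold w2; solve_continuous).
  assert (HGb : forall t, 0 <= G t <= M).
  { intros t; split.
    - apply RInt_ge_0; [lra | eexists; apply IG, Ce | intros; apply Hpos].
    - apply Rle_trans with (2 := HM t).
      apply (RInt_le (fun y => int e y t) (fun y => int w2 y t));
        [lra | eexists; apply IG, Ce | eexists; apply IG, Cw2 |].
      intros y _; apply RInt_le;
        [lra | eexists; apply Iint, Ce | eexists; apply Iint, Cw2 |].
      intros z _; unfold e, w2; pose proof (SIN_bound (k * z)); nra. }
  pose proof (ancient_decay_zero G dG c M Hc DG Hdecay HGb) as HG0.
  (* The weight vanishes on the walls, where the boundary values are used instead. Inside, [y] is
     moved into one period and the two nested integrals of a nonnegative function are undone in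
     turn. *)
  intros y t z Hz.
  destruct (Req_dec z 0) as [->|]; [apply Hbd|].
  destruct (Req_dec z h) as [->|]; [apply Hbd|].
  destruct (periodic_fundamental_domain (fun y => w y t z) L HL
    (fun y => Hper y t z) y) as [y' [Hy' ->]].
  assert (Hint0 : int e y' t = 0).
  { apply (RInt_zero_continuous (fun y => int e y t) 0 L);
      [intros; apply Cslice, Ce | intros; apply Hpos | exact HL | | exact Hy'].
    fold (G t); rewrite HG0; lra. }
  assert (He0 : e y' t z = 0).
  { apply (RInt_zero_continuous (e y' t) 0 h);
      [intros; apply Cz, Ce | | exact Hh | fold (int e y' t); lra | exact Hz].
    intros s Hs; unfold e; apply Rmult_le_pos; [nra | apply Hphi, Hs]. }
  unfold e in He0; pose proof (Hphi' z ltac:(lra)).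
  apply Rmult_integral in He0; destruct He0 as [He0|]; [|lra].
  apply Rmult_integral in He0; tauto.
Qed.

(** * Partial derivatives on the channel *)

(* Freezing [f] outside the walls keeps it continuous on the whole space, so that
   no one-sided limits are needed in the integrals over [0, h]; only the
   [z]-derivatives break down, and only at the walls. *)
Definition clamped (h : R) (f : spacetime -> R) (y t z : R) : R :=
  f ((0, y, clamp h z), t).

(** Clamping sends every point into the channel, so continuity relative to the channel is enough. *)
Lemma continuous3_clamped (h : R) (f : spacetime -> R) :
  0 < h -> continuous_on (channel h) f -> continuous3 (clamped h f).
Proof.
  intros Hh Hf q; unfold clamped.
  set (g := fun q : R * R * R => ((0, fst (fst q), clamp h (snd q)), snd (fst q))).
  assert (Hg : continuous g q).
  { unfold g; repeat apply continuous_pair; solve_continuous. }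
  assert (HD : forall q, channel h (g q)) by (intros; apply clamp_bounds, Hh).
  apply (filterlim_comp _ _ _ g f _ (within (channel h) (locally (g q)))).
  - intros P HP; unfold within in HP.
    specialize (Hg _ HP); unfold filtermap in *.
    apply filter_imp with (2 := Hg); intros r Hr; apply Hr, HD.
  - apply Hf, HD.
Qed.

(** Properness gives uniqueness of the limit defining a partial derivative, also at a wall.
    Increments pointing from [x3] towards the farther wall, of size at most [h / 2], stay in the
    channel. *)
Lemma channel_increments_proper (h : R) (v : Defs.var) (q : spacetime) :
  0 < h -> channel h q ->
  ProperFilter' (within (fun s => channel h (shift v s q)) (locally' 0)).
Proof.
  intros Hh Hq; split; [|apply within_filter, within_filter, locally_filter].
  intros [eps Heps].
  assert (He := cond_pos eps).
  assert (Hex : exists s, s <> 0 /\ Rabs s < eps /\ channel h (shift v s q)).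
  { destruct q as [[[x1 x2] x3] t]; simpl in Hq.
    pose proof (Rmin_l (eps / 2) (h / 2)); pose proof (Rmin_r (eps / 2) (h / 2)).
    assert (Hm : 0 < Rmin (eps / 2) (h / 2)) by (apply Rmin_glb_lt; lra).
    set (m := Rmin (eps / 2) (h / 2)) in *.
    destruct (Rle_dec x3 (h / 2)); [exists m | exists (- m)];
      (split; [lra|split; [apply Rabs_lt_between; lra|]]);
      destruct v as [[]|]; simpl; lra. }
  destruct Hex as [s [Hs0 [Hse Hs]]].
  apply (Heps s); [|exact Hs0|exact Hs].
  change (Rabs (s - 0) < eps); rewrite Rminus_0_r; exact Hse.
Qed.

Lemma partial_eq (h : R) (v : Defs.var) (f : spacetime -> R) (q : spacetime) (l : R) :
  0 < h -> channel h q -> is_partial (channel h) v f q l ->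
  partial (channel h) v f q = l.
Proof.
  intros Hh Hq Hl; unfold partial, is_partial.
  apply (iota_filterlim_locally (FF := channel_increments_proper h v q Hh Hq)
           (fun s => (f (shift v s q) - f q) / s) l Hl).
Qed.

Lemma is_partial_partial (h : R) (v : Defs.var) (f : spacetime -> R) (q : spacetime) :
  0 < h -> channel h q -> ex_partial (channel h) v f ->
  is_partial (channel h) v f q (partial (channel h) v f q).
Proof.
  intros Hh Hq Hf; destruct (Hf q Hq) as [l Hl].
  rewrite (partial_eq h v f q l Hh Hq Hl); exact Hl.
Qed.

Lemma partial_zero (h : R) (v : Defs.var) (f : spacetime -> R) (q : spacetime) :
  0 < h -> channel h q -> (forall r, channel h r -> f r = 0) ->
  partial (channel h) v f q = 0.
Proof.
  intros Hh Hq Hf; apply partial_eq; [exact Hh | exact Hq|].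
  apply filterlim_within_ext with (fun _ => 0).
  - intros s Hs; rewrite (Hf _ Hs), (Hf _ Hq); unfold Rdiv; ring.
  - apply filterlim_const.
Qed.

(** When all small increments stay in [D], the restricted limit is the usual two-sided derivative of
    [F], the restriction of [f] to the line through [q] in direction [v]. *)
Lemma is_partial_is_derive (D : spacetime -> Prop) (v : Defs.var) (f : spacetime -> R)
    (q : spacetime) (l : R) (F : R -> R) (x : R) :
  (forall s, f (shift v s q) = F (x + s)) -> f q = F x ->
  locally 0 (fun s => D (shift v s q)) ->
  is_partial D v f q l -> is_derive F x l.
Proof.
  intros Hs Hq [d1 HD] Hl; apply is_derive_Reals; intros eps Heps.
  destruct (proj1 (filterlim_locally _ _) Hl (mkposreal _ Heps)) as [d2 Hd2].
  assert (Hd : 0 < Rmin d1 d2) by (apply Rmin_glb_lt; apply cond_pos).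
  exists (mkposreal _ Hd); intros s Hs0 Hsd; simpl in Hsd.
  rewrite <- Hs, <- Hq.
  pose proof (Rmin_l d1 d2); pose proof (Rmin_r d1 d2).
  assert (Hball : forall d : R, Rmin d1 d2 <= d -> Rabs (s - 0) < d)
    by (intros; rewrite Rminus_0_r; lra).
  apply (Hd2 s); [apply Hball; lra | exact Hs0 | apply HD, Hball; lra].
Qed.

Lemma is_derive_partial_time (h : R) (f : spacetime -> R) (x1 x2 x3 t : R) :
  0 < h -> 0 <= x3 <= h -> ex_partial (channel h) Time f ->
  is_derive (fun t => f ((x1, x2, x3), t)) t
    (partial (channel h) Time f ((x1, x2, x3), t)).
Proof.
  intros Hh Hx Hf.
  apply (is_partial_is_derive (channel h) Time f ((x1, x2, x3), t));
    [reflexivity | reflexivity | | apply is_partial_partial; assumption].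
  apply filter_forall; intros s; exact Hx.
Qed.

Lemma is_derive_partial_ax1 (h : R) (f : spacetime -> R) (x1 x2 x3 t : R) :
  0 < h -> 0 <= x3 <= h -> ex_partial (channel h) (Space ax1) f ->
  is_derive (fun x1 => f ((x1, x2, x3), t)) x1
    (partial (channel h) (Space ax1) f ((x1, x2, x3), t)).
Proof.
  intros Hh Hx Hf.
  apply (is_partial_is_derive (channel h) (Space ax1) f ((x1, x2, x3), t));
    [reflexivity | reflexivity | | apply is_partial_partial; assumption].
  apply filter_forall; intros s; exact Hx.
Qed.

Lemma is_derive_partial_ax2 (h : R) (f : spacetime -> R) (x1 x2 x3 t : R) :
  0 < h -> 0 <= x3 <= h -> ex_partial (channel h) (Space ax2) f ->
  is_derive (fun x2 => f ((x1, x2, x3), t)) x2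
    (partial (channel h) (Space ax2) f ((x1, x2, x3), t)).
Proof.
  intros Hh Hx Hf.
  apply (is_partial_is_derive (channel h) (Space ax2) f ((x1, x2, x3), t));
    [reflexivity | reflexivity | | apply is_partial_partial; assumption].
  apply filter_forall; intros s; exact Hx.
Qed.

Lemma is_derive_partial_ax3 (h : R) (f : spacetime -> R) (x1 x2 x3 t : R) :
  0 < h -> 0 < x3 < h -> ex_partial (channel h) (Space ax3) f ->
  is_derive (fun x3 => f ((x1, x2, x3), t)) x3
    (partial (channel h) (Space ax3) f ((x1, x2, x3), t)).
Proof.
  intros Hh Hx Hf.
  apply (is_partial_is_derive (channel h) (Space ax3) f ((x1, x2, x3), t));
    [reflexivity | reflexivity | | apply is_partial_partial; [| simpl; lra |]; assumption].
  assert (Hd : 0 < Rmin x3 (h - x3)) by (apply Rmin_glb_lt; lra).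
  exists (mkposreal _ Hd); intros s Hs.
  change (Rabs (s - 0) < Rmin x3 (h - x3)) in Hs; apply Rabs_lt_between in Hs.
  pose proof (Rmin_l x3 (h - x3)); pose proof (Rmin_r x3 (h - x3)).
  simpl; lra.
Qed.

Lemma locally_clamp (h z : R) : 0 < z < h -> locally z (fun s => clamp h s = s).
Proof.
  intros Hz.
  assert (Hd : 0 < Rmin z (h - z)) by (apply Rmin_glb_lt; lra).
  exists (mkposreal _ Hd); intros s Hs.
  change (Rabs (s - z) < Rmin z (h - z)) in Hs; apply Rabs_lt_between in Hs.
  pose proof (Rmin_l z (h - z)); pose proof (Rmin_r z (h - z)).
  apply clamp_id; lra.
Qed.

Lemma is_derive_clamped_z (h : R) (f : spacetime -> R) (y t z : R) :
  0 < h -> 0 < z < h -> ex_partial (channel h) (Space ax3) f ->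
  is_derive (clamped h f y t) z (clamped h (partial (channel h) (Space ax3) f) y t z).
Proof.
  intros Hh Hz Hf; unfold clamped at 2; rewrite clamp_id by lra.
  apply is_derive_ext_loc with (fun z => f ((0, y, z), t)).
  - apply filter_imp with (2 := locally_clamp h z Hz).
    intros s Hs; unfold clamped; rewrite Hs; reflexivity.
  - apply is_derive_partial_ax3; assumption.
Qed.

(** * * Reduction of the channel flow to the strip *)

Lemma parallel_flow_invariant (h : R) (U : spacetime -> R) (x1 x2 x3 t : R) :
  0 < h -> 0 <= x3 <= h -> ex_partial (channel h) (Space ax1) U ->
  (forall q, channel h q -> partial (channel h) (Space ax1) U q = 0) ->
  U ((x1, x2, x3), t) = U ((0, x2, x3), t).
Proof.
  intros Hh Hx Hex H0.
  assert (D : forall x, is_derive (fun x => U ((x, x2, x3), t)) x 0).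
  { intros x; rewrite <- (H0 ((x, x2, x3), t)) by exact Hx.
    apply is_derive_partial_ax1; assumption. }
  destruct (MVT_gen (fun x => U ((x, x2, x3), t)) 0 x1 (fun _ => 0)) as [c [_ Hc]].
  - intros; apply D.
  - intros; apply continuity_pt_filterlim.
    apply (ex_derive_continuous (fun x => U ((x, x2, x3), t))); eexists; apply D.
  - lra.
Qed.

Theorem corollary3p1 :
  forall (nu h Pi1 Pi2 p10 : R) (U P : spacetime -> R),
  0 < nu -> 0 < h -> 0 < Pi1 -> 0 < Pi2 ->
  navier_stokes (channel h) nu (parallel_flow U) P ->
  no_slip h (parallel_flow U) ->
  (forall i, smooth_on (channel h) (parallel_flow U i)) ->
  periodic_on (channel h) ax1 Pi1 (parallel_flow U) ->
  periodic_on (channel h) ax2 Pi2 (parallel_flow U) ->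
  (exists M, forall t, cell_energy Pi1 Pi2 h (parallel_flow U) t <= M) ->
  (forall q, channel h q -> partial (channel h) (Space ax1) P q = p10) ->
  exists V : R -> R -> R,
  forall x1 x2 x3 t, 0 <= x3 <= h ->
    U ((x1, x2, x3), t) = V x3 t /\
    is_series (fun n : nat =>
        let k := S n in
        2 * p10 * h ^ 2 / (nu * (INR k * PI) ^ 3) * ((-1) ^ k - 1)
        * sin (PI * INR k * x3 / h)) (V x3 t) /\
    V x3 t = - (p10 / (2 * nu)) * x3 * (h - x3).
Proof.
  intros nu h Pi1 Pi2 p10 U P Hnu Hh HPi1 HPi2 [_ [Hns Hdiv]] Hslip Hsm _ Hper2 [M HM] HP.
  set (D := channel h) in *.
  (* Order 2 supplies the second derivatives of the viscous term together with their continuity. *)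
  destruct (Hsm ax1 2%nat) as [C0 H1]; simpl parallel_flow in C0, H1.
  assert (E1 : forall v, ex_partial D v U) by (intros v; exact (proj1 (H1 v))).
  assert (C1 : forall v, continuous_on D (partial D v U)) by (intros v; exact (proj1 (proj2 (H1 v)))).
  assert (E2 : forall v v', ex_partial D v' (partial D v U))
    by (intros v v'; exact (proj1 (proj2 (proj2 (H1 v)) v'))).
  assert (C2 : forall v v', continuous_on D (partial D v' (partial D v U)))
    by (intros v v'; exact (proj1 (proj2 (proj2 (proj2 (H1 v)) v')))).
  assert (U1 : forall q, D q -> partial D (Space ax1) U q = 0).
  { intros q Hq; specialize (Hdiv q Hq); unfold divergence, sum_axes in Hdiv; simpl in Hdiv.
    rewrite !(partial_zero h _ (fun _ => 0)) in Hdiv by (trivial || exact Hq).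
    lra. }
  assert (U11 : forall q, D q -> partial D (Space ax1) (partial D (Space ax1) U) q = 0)
    by (intros q Hq; apply (partial_zero h); assumption).
  (* The advection term reduces to [U] times its [x1]-derivative, which is 0, and the Laplacian
     loses its [x1] part. *)
  assert (Ut : forall q, D q -> partial D Time U q
     = nu * (partial D (Space ax2) (partial D (Space ax2) U) q
           + partial D (Space ax3) (partial D (Space ax3) U) q) - p10).
  { intros q Hq; specialize (Hns ax1 q Hq).
    unfold advection, laplacian, sum_axes in Hns; simpl in Hns.
    rewrite (HP q Hq), (U1 q Hq) in Hns.
    rewrite (U11 q Hq) in Hns.
    lra. }
  assert (Uinv : forall x1 x2 x3 t, 0 <= x3 <= h -> U ((x1, x2, x3), t) = U ((0, x2, x3), t)).
  { intros; apply (parallel_flow_invariant h); auto. }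
  (* [- Sz] is the stationary Poiseuille profile: [nu] times the second derivative [- 2 a] of [Sz]
     is [- p10], which absorbs the pressure gradient. *)
  set (a := p10 / (2 * nu)).
  set (Sz := fun z => a * clamp h z * (h - clamp h z)).
  set (w := fun y t z => clamped h U y t z + Sz z).
  set (wz := fun y t z => clamped h (partial D (Space ax3) U) y t z + a * (h - 2 * clamp h z)).
  set (wzz := fun y t z =>
    clamped h (partial D (Space ax3) (partial D (Space ax3) U)) y t z - 2 * a).
  assert (CU : continuous3 (clamped h U)) by (apply continuous3_clamped; assumption).
  assert (CU1 : forall v, continuous3 (clamped h (partial D v U)))
    by (intros; apply continuous3_clamped; auto).
  assert (CU2 : forall v v', continuous3 (clamped h (partial D v' (partial D v U))))
    by (intros; apply continuous3_clamped; auto).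
  (* [solve_continuous] looks for unquantified [continuous3] facts, so the instances needed for [wz]
     and [wzz] are stated separately. *)
  pose proof (CU1 (Space ax3)) as CU3; pose proof (CU2 (Space ax3) (Space ax3)) as CU33.
  assert (CS : continuous3 (fun _ _ z => Sz z))
    by (intros q; unfold Sz; solve_continuous).
  assert (Cw : continuous3 w).
  { intros q; apply (continuous_plus _ _ q (CU q) (CS q)). }
  set (uu := fun y t z => clamped h U y t z * clamped h U y t z).
  assert (Cuu : continuous3 uu) by (intros q; unfold uu; solve_continuous).
  set (ss := RInt (fun z => 2 * (Sz z * Sz z)) 0 h).
  assert (Hss : is_RInt (fun z => 2 * (Sz z * Sz z)) 0 h ss).
  { apply is_RInt_everywhere_continuous; intros z; unfold Sz; solve_continuous. }
  assert (Iuu : forall y t, is_RInt (uu y t) 0 h (RInt (uu y t) 0 h)).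
  { intros y t; apply is_RInt_everywhere_continuous; intros z.
    apply (continuous3_comp uu (fun _ => y) (fun _ => t) (fun z => z));
      [exact Cuu | solve_continuous ..]. }
  assert (Cin : forall f t, continuous3 f -> forall y, continuous (fun y => RInt (f y t) 0 h) y).
  { intros f t Hf y.
    apply (continuous_RInt_param (fun y z => f y t z)); [lra|].
    intros q; solve_continuous. }
  set (E := fun t => RInt (fun y => RInt (uu y t) 0 h) 0 Pi2).
  (* As [U] does not depend on [x1], the cell energy is [Pi1] times the energy [E] of the slice
     [x1 = 0]. *)
  assert (HE : forall t, E t <= M / Pi1).
  { intros t; specialize (HM t).
    replace (cell_energy Pi1 Pi2 h (parallel_flow U) t) with (E t * Pi1) in HM.
    - apply (Rmult_le_reg_r Pi1); [exact HPi1|].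
      replace (M / Pi1 * Pi1) with M by (field; lra); exact HM.
    - unfold cell_energy; rewrite (RInt_ext _ (fun _ => E t)).
      + rewrite RInt_const; unfold scal; simpl; unfold mult; simpl; ring.
      + intros x1 _; apply RInt_ext; intros y _; apply RInt_ext.
        rewrite Rmin_left, Rmax_right by lra; intros z Hz.
        unfold sum_axes, uu, clamped; simpl parallel_flow.
        rewrite clamp_id, Uinv by lra; rewrite !Rmult_0_l, !Rplus_0_r; reflexivity. }
  (* From [(u + s)^2 <= 2 u^2 + 2 s^2], integrated over the slice; [ss] is the contribution of the
     profile. *)
  assert (Hww : forall t, RInt (fun y => RInt (fun z => w y t z * w y t z) 0 h) 0 Pi2
            <= 2 * (M / Pi1) + Pi2 * ss).
  { intros t.
    set (ww := fun y t z => w y t z * w y t z).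
    assert (Cww : continuous3 ww) by (intros q; unfold ww; solve_continuous).
    assert (Hin : forall y, RInt (ww y t) 0 h <= 2 * RInt (uu y t) 0 h + ss).
    { intros y.
      pose proof (is_RInt_plus _ _ _ _ _ _
        (is_RInt_scal _ _ _ 2 _ (Iuu y t)) Hss) as Hr.
      refine (is_RInt_le _ _ _ _ _ _ _ (is_RInt_everywhere_continuous (ww y t) 0 h _) Hr _);
        [lra | | ].
      - intros z; apply (continuous3_comp ww (fun _ => y) (fun _ => t) (fun z => z));
          [exact Cww | solve_continuous ..].
      - intros z _; unfold ww, uu, w, plus, scal; simpl; unfold mult; simpl.
        pose proof (pow2_ge_0 (clamped h U y t z - Sz z)); nra. }
    apply Rle_trans with (2 * E t + Pi2 * ss).
    - pose proof (is_RInt_plus _ _ _ _ _ _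
        (is_RInt_scal _ _ _ 2 _
          (is_RInt_everywhere_continuous (fun y => RInt (uu y t) 0 h) 0 Pi2 (Cin uu t Cuu)))
        (is_RInt_const 0 Pi2 ss)) as Hr.
      replace (2 * E t + Pi2 * ss) with (2 * E t + (Pi2 - 0) * ss) by ring.
      refine (is_RInt_le _ _ _ _ _ _ _
        (is_RInt_everywhere_continuous (fun y => RInt (ww y t) 0 h) 0 Pi2 (Cin ww t Cww)) Hr _).
      + lra.
      + intros y _; apply Hin.
    - specialize (HE t); lra. }
  assert (Hw0 : forall y t z, 0 <= z <= h -> w y t z = 0).
  { apply (heat_ancient_zero nu h Pi2 (2 * (M / Pi1) + Pi2 * ss) w
      (clamped h (partial D Time U))
      (clamped h (partial D (Space ax2) U))
      (clamped h (partial D (Space ax2) (partial D (Space ax2) U))) wz wzz);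
      try solve [trivial].
    - intros q; unfold wz; solve_continuous.
    - intros q; unfold wzz; solve_continuous.
    - intros y t z; unfold w; evar_last.
      + apply (is_derive_plus (fun t => clamped h U y t z) (fun _ => Sz z));
          [|apply is_derive_const].
        apply is_derive_partial_time; [exact Hh | apply clamp_bounds, Hh | apply E1].
      + apply Rplus_0_r.
    - intros y t z; unfold w; evar_last.
      + apply (is_derive_plus (fun y => clamped h U y t z) (fun _ => Sz z));
          [|apply is_derive_const].
        apply (is_derive_partial_ax2 h U); [exact Hh | apply clamp_bounds, Hh | apply E1].
      + apply Rplus_0_r.
    - intros y t z.
      apply (is_derive_partial_ax2 h (partial D (Space ax2) U));
        [exact Hh | apply clamp_bounds, Hh | apply E2].
    - intros y t z Hz; unfold w, wz.
      apply (is_derive_plus (clamped h U y t) Sz); [apply is_derive_clamped_z; auto|].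
      rewrite (clamp_id h z) by lra.
      apply is_derive_ext_loc with (fun z => a * z * (h - z)).
      + apply filter_imp with (2 := locally_clamp h z Hz).
        intros s Hs; unfold Sz; rewrite Hs; reflexivity.
      + auto_derive; [trivial | ring].
    - intros y t z Hz; unfold wz, wzz.
      apply (is_derive_plus (clamped h (partial D (Space ax3) U) y t)
               (fun z => a * (h - 2 * clamp h z)));
        [apply is_derive_clamped_z; auto; apply E2|].
      apply is_derive_ext_loc with (fun z => a * (h - 2 * z)).
      + apply filter_imp with (2 := locally_clamp h z Hz).
        intros s Hs; rewrite Hs; reflexivity.
      + auto_derive; [trivial | ring].
    - intros y t z Hz; unfold wzz, clamped; rewrite clamp_id by lra.
      rewrite Ut by (simpl; lra); unfold a; field; lra.
    - intros y t; unfold w, Sz, clamped; rewrite !clamp_id by lra.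
      destruct (Hslip ax1 0 y t) as [H0 Hh0]; simpl in H0, Hh0.
      rewrite H0, Hh0; split; ring.
    - intros y t z; unfold w, clamped; f_equal.
      apply (Hper2 ax1 ((0, y, clamp h z), t)); apply clamp_bounds, Hh. }
  exists (fun z _ => - a * z * (h - z)).
  intros x1 x2 x3 t Hx; split; [|split].
  - specialize (Hw0 x2 t x3 Hx).
    unfold w, Sz, clamped in Hw0; rewrite clamp_id in Hw0 by exact Hx.
    rewrite Uinv by exact Hx; lra.
  - apply parabola_sine_series; assumption.
  - reflexivity.
Qed.
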